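(* Let $\mathcal{H}$ be a real Hilbert space and let $f:\mathcal{H}\to\mathbb{R}$ be a convex differentiable function whose gradient $\nabla f$ is Lipschitz continuous on bounded subsets of $\mathcal{H}$ and whose set of minimizers $S=\operatorname{argmin} f$ is nonempty. Let $t_0>0$, $\delta>0$, $0<p<2$, and set $\varepsilon(t)=1/t^p$ for $t\ge t_0$. Let $x:[t_0,+\infty[\to\mathcal{H}$ be a solution trajectory of $$\ddot{x}(t)+\frac{\delta}{t^{p/2}}\dot{x}(t)+\nabla f(x(t))+\frac{1}{t^p}x(t)=0 .$$ Then, as $t\to+\infty$, $$f(x(t))-\min_{\mathcal{H}} f=\mathcal{O}\left(\frac{1}{t^{p}}\right)\qquad\text{and}\qquad \|x(t)-x_{\varepsilon(t)}\|^2=\mathcal{O}\left(\frac{1}{t^{\frac{2-p}{2}}}\right),$$ where $x_{\varepsilon(t)}$ denotes the unique minimizer over $\mathcal{H}$ of $y\mapsto f(y)+\frac{\varepsilon(t)}{2}\|y\|^2$. Consequently, $x(t)$ converges strongly, as $t\to+\infty$, to the element $x^*$ of minimum norm of $S$.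
   Context: $\mathcal{H}$ carries the scalar product $\langle\cdot,\cdot\rangle$ and the norm $\|x\|^2=\langle x,x\rangle$. A solution trajectory is a twice continuously differentiable function $x:[t_0,+\infty[\to\mathcal{H}$ satisfying the differential equation for all $t\ge t_0$. The element $x^*$ of minimum norm of $S$ is the projection of $0$ onto the closed convex set $S$. *)

(* Defs.v *)
From HB Require Import structures.
From mathcomp Require Import all_boot all_order all_algebra.
From mathcomp Require Import all_classical all_reals all_analysis.
Set Implicit Arguments.
Unset Strict Implicit.
Unset Printing Implicit Defensive.
Import Order.TTheory GRing.Theory Num.Theory.
Import numFieldNormedType.Exports.
Local Open Scope classical_set_scope.
Local Open Scope ring_scope.

(* The Riesz representer of the differential of f at y; it exists and is unique
   when f is differentiable at y and H is complete for the norm of ip. *)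
Definition gradient (R : realType) (H : completeNormedModType R)
    (ip : {dot H for idfun}) (f : H -> R) (y : H) : H :=
  get [set g : H | forall h : H, 'd f y h = ip g h].

Definition argmin (R : realType) (T : Type) (A : set T) (f : T -> R) : set T :=
  [set y | A y /\ forall z, A z -> f y <= f z].

(* An infimum, which is a minimum as soon as argmin setT f is nonempty. *)
Definition min_value (R : realType) (T : Type) (f : T -> R) : R :=
  inf (range f).

(* Derivative relative to A, hence one-sided at an endpoint of an interval A. *)
Definition is_derive_within (R : realType) (H : normedModType R)
    (A : set R) (x : R -> H) (t : R) (v : H) : Prop :=
  (s - t)^-1 *: (x s - x t) @[s --> within A t^'] --> v.

(* Only the values of x on [t0, +oo[ matter. *)
Definition solution_trajectory (R : realType) (H : completeNormedModType R)
    (ip : {dot H for idfun}) (f : H -> R) (gamma eps : R -> R) (t0 : R)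
    (x : R -> H) : Prop :=
  let I := `[t0, +oo[%classic in
  exists x' x'' : R -> H,
    [/\ forall t, I t -> is_derive_within I x t (x' t),
        forall t, I t -> is_derive_within I x' t (x'' t),
        {within I, continuous x''} &
        forall t, I t ->
          x'' t + gamma t *: x' t + gradient ip f (x t) + eps t *: x t = 0].

(* Gives access to Landau notations at +oo. *)
Canonical pinfty_filter_on (R : realType) :=
  FilterType (pinfty_nbhs R) (@proper_pinfty_nbhs R).

(* Main.v *)
(** Write e(t) = t^(-p/2), so that eps(t) = e(t)^2, and let z_t be the minimizer
    of phi_t = f + eps(t)/2 |.|^2.  The proof is a Lyapunov analysis of
      E(t) = phi_t(x(t)) - phi_t(z_t) + |lam e(t) (x(t) - z_t) + x'(t)|^2 / 2,
    which satisfies E' <= - kap e E + M e^2 / t and hence E = O(e(t)/t).  Both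
    rates follow, since phi_t is strongly convex with modulus eps(t).
    As z_t need not be differentiable, the differential inequality is replaced
    by a barrier argument: if E reaches K e(s)/s at a time s, then E lies to the
    right of s below a smooth function in which z_s is frozen and the drift of
    z_t is bounded by |z_t - z_s| <= 4 rho (1 - eps(t)/eps(s)); the derivative of
    that function at s is smaller than the derivative of the barrier K e(t)/t.
    Strong convergence of z_t needs no weak topology: |z_t|^2 increases, is
    bounded by the norms of the minimizers of f, and its increments control
    |z_t - z_s|^2. *)
Require Import Defs.
From HB Require Import structures.
From mathcomp Require Import all_boot all_order all_algebra.
From mathcomp Require Import all_classical all_reals all_analysis.
From mathcomp Require Import ring lra.
Import Order.TTheory GRing.Theory Num.Theory.
Import numFieldNormedType.Exports.
Local Open Scope classical_set_scope.
Local Open Scope ring_scope.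
Set Implicit Arguments.
Unset Strict Implicit.
Unset Printing Implicit Defensive.

(** * Inner product calculus: continuity and product rule *)

Section InnerProduct.
Context (R : realType) (H : completeNormedModType R) (ip : {dot H for idfun}).
Context (norm_ip : forall y : H, `|y| ^+ 2 = ip y y).
Implicit Types u v w : H.

Lemma ipC u v : ip u v = ip v u.
Proof. by rewrite hermC expr0 mul1r. Qed.

Lemma ipDr u v w : ip u (v + w) = ip u v + ip u w.
Proof. exact: linearDr. Qed.

Lemma ipZr a u v : ip u (a *: v) = a * ip u v.
Proof. by rewrite linearZr_LR. Qed.

Lemma ipDl u v w : ip (u + v) w = ip u w + ip v w.
Proof. by rewrite ipC ipDr !(ipC w). Qed.

Lemma ipZl a u v : ip (a *: u) v = a * ip u v.
Proof. by rewrite ipC ipZr ipC. Qed.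

Lemma ipBr u v w : ip u (v - w) = ip u v - ip u w.
Proof. by rewrite -scaleN1r ipDr ipZr mulN1r. Qed.

Lemma ipBl u v w : ip (u - v) w = ip u w - ip v w.
Proof. by rewrite ipC ipBr !(ipC w). Qed.

Definition ipE := (ipBl, ipBr, ipDl, ipDr, ipZl, ipZr).

Lemma sqr_normD u v : `|u + v| ^+ 2 = `|u| ^+ 2 + 2 * ip u v + `|v| ^+ 2.
Proof. by rewrite !norm_ip !ipE [ip v u]ipC; ring. Qed.

Lemma sqr_normB u v : `|u - v| ^+ 2 = `|u| ^+ 2 - 2 * ip u v + `|v| ^+ 2.
Proof. by rewrite !norm_ip !ipE [ip v u]ipC; ring. Qed.

Lemma sqr_normZ a u : `|a *: u| ^+ 2 = a ^+ 2 * `|u| ^+ 2.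
Proof. by rewrite !norm_ip !ipE; ring. Qed.

Lemma sqr_norm_mid u v : `|2^-1 *: (u + v)| ^+ 2 =
  `|u| ^+ 2 / 2 + `|v| ^+ 2 / 2 - `|u - v| ^+ 2 / 4.
Proof. by rewrite sqr_normZ sqr_normD sqr_normB; field. Qed.

(** Polarization expresses [ip] through norms, whose continuity is known; [norm_ip] is the link
    between [ip] and the topology. *)
Lemma cvg_ip (T : Type) (F : set_system T) {FF : Filter F} (a b : T -> H) u v :
  a t @[t --> F] --> u -> b t @[t --> F] --> v ->
  ip (a t) (b t) @[t --> F] --> ip u v.
Proof.
move=> au bv.
have polar x y : ip x y = (`|x + y| * `|x + y| - `|x - y| * `|x - y|) / 4.
  by rewrite -!expr2 sqr_normD sqr_normB; field.
rewrite polar; under eq_fun do rewrite polar.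
apply: cvgM; last exact: cvg_cst.
have sq (c : T -> H) w : c t @[t --> F] --> w ->
    `|c t| * `|c t| @[t --> F] --> `|w| * `|w|.
  by move=> cw; apply: cvgM; exact: cvg_norm.
by apply: cvgB; apply: sq; [exact: cvgD|exact: cvgB].
Qed.

Lemma is_derive_ip (a b : R -> H) (s : R) (a' b' : H) :
  is_derive s (1 : R) a a' -> is_derive s (1 : R) b b' ->
  is_derive s (1 : R) (fun t => ip (a t) (b t)) (ip a' (b s) + ip (a s) b').
Proof.
move=> [da <-] [db <-].
have cb : b (h *: 1 + s) @[h --> (0 : R)^'] --> b s.
  have /differentiable_continuous : differentiable b s by apply/derivable1_diffP.
  have shift_cvg : (h *: (1 : R) + s) @[h --> (0 : R)^'] --> s.
    suff : (h *: (1 : R) + s) @[h --> (0 : R)] --> 0 *: (1 : R) + s.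
      by rewrite scale0r add0r; exact: cvg_within_filter.
    by apply: cvgD; [apply: cvgZr_tmp; exact: cvg_id|exact: cvg_cst].
  by move=> cb; exact: (cvg_comp _ _ shift_cvg cb).
have cvg_quot : h^-1 *: (ip (a (h *: 1 + s)) (b (h *: 1 + s)) - ip (a s) (b s))
    @[h --> (0 : R)^'] --> ip ('D_1 a s) (b s) + ip (a s) ('D_1 b s).
  rewrite (_ : (fun h : R => _) = fun h =>
      ip (h^-1 *: (a (h *: 1 + s) - a s)) (b (h *: 1 + s)) +
      ip (a s) (h^-1 *: (b (h *: 1 + s) - b s))); last first.
    by apply/funext => h; rewrite !ipE /GRing.scale/=; ring.
  apply: cvgD; apply: cvg_ip => //; exact: cvg_cst.
by apply: DeriveDef; [apply/cvg_ex; eexists; exact: cvg_quot|exact: cvg_lim].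
Qed.

End InnerProduct.

(** * Minimization of strongly convex functions in a complete space *)

Section StronglyConvexMinimization.
Context (R : realType) (H : completeNormedModType R).

Lemma cauchy_norm_cvg (T : Type) (F : set_system T) {FF : ProperFilter F}
    (u : T -> H) :
  (forall e : R, 0 < e -> exists a, \forall b \near F, `|u a - u b| < e) ->
  cvg (u t @[t --> F]).
Proof.
move=> cu; apply: cauchy_cvg; apply: cauchy_exP => e e0.
have [a ua] := cu _ e0; exists (u a).
by rewrite /nbhs/=; apply: filterS ua => b; rewrite -ball_normE.
Qed.

(** A minimizing sequence is Cauchy: the midpoint of two of its terms has value at least the
    infimum, so [c] times their squared distance is at most the mean of their excesses. The midpoint
    of [y] and the minimizer then gives the growth term. *)
Lemma strongly_convex_argmin (C : set H) (g : H -> R) (c : R) :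
  0 < c -> closed C -> C !=set0 -> has_lbound (g @` C) -> continuous g ->
  (forall u v, C u -> C v -> C (2^-1 *: (u + v)) /\
    g (2^-1 *: (u + v)) <= (g u + g v) / 2 - c * `|u - v| ^+ 2) ->
  exists2 z, C z & forall y, C y -> g z + 2 * c * `|y - z| ^+ 2 <= g y.
Proof.
move=> c0 clC C0 lbg cg mid; pose m : R := inf (g @` C).
have hinf : has_inf (g @` C) by split => //; exact: image_nonempty.
have mle y : C y -> m <= g y by move=> Cy; apply: ge_inf => //; exists y.
have ex n : exists y, C y /\ g y < m + harmonic n.
  have n0 : 0 < harmonic n :> R by rewrite harmonic_gt0.
  by have [_ [y Cy <-] gy] := inf_adherent n0 hinf; exists y.
have [u uP] := choice ex.
have udist n k : c * `|u n - u k| ^+ 2 <= (harmonic n + harmonic k) / 2.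
  have [Cn gn] := uP n; have [Ck gk] := uP k.
  have [Cmid gmid] := mid _ _ Cn Ck; have := mle _ Cmid.
  by move=> ?; lra.
have [z uz] : exists z : H, u n @[n --> \oo] --> z.
  suff cu : cvg (u n @[n --> \oo]) by exists (lim (u n @[n --> \oo])).
  apply: cauchy_norm_cvg => e e0.
  have ce0 : 0 < c * e ^+ 2 by rewrite mulr_gt0// exprn_gt0.
  have [N _ NP] := near_infty_natSinv_lt (PosNum ce0); exists N; exists N => // k Nk.
  have hN : harmonic N < c * e ^+ 2 := NP _ (leqnn N).
  have hk : harmonic k < c * e ^+ 2 := NP _ Nk.
  have : c * `|u N - u k| ^+ 2 < c * e ^+ 2 by have ? := udist N k; lra.
  by rewrite ltr_pM2l// ltr_pXn2r ?nnegrE ?normr_ge0 ?(ltW e0)//.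
have Cz : C z.
  by apply: (closed_cvg C clC _ _ uz); apply: nearW => n; exact: (uP n).1.
have gz : g z <= m.
  have gu : g (u n) @[n --> \oo] --> g z by apply: continuous_cvg => //; exact: cg.
  have mu : (m + harmonic n : R) @[n --> \oo] --> m + 0.
    by apply: cvgD; [exact: cvg_cst|exact: cvg_harmonic].
  rewrite -[m]addr0 -(cvg_lim (@Rhausdorff R) gu) -(cvg_lim (@Rhausdorff R) mu).
  apply: ler_lim; [by apply/cvg_ex; exists (g z)|by apply/cvg_ex; exists (m + 0)|].
  by apply: nearW => n; apply: ltW; exact: (uP n).2.
exists z => // y Cy; have [Cw gw] := mid _ _ Cy Cz.
by have ? := mle _ Cw; lra.
Qed.

Lemma argmin_uniq (C : set H) (g : H -> R) (c : R) (z : H) :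
  0 < c -> C z -> (forall y, C y -> g z + 2 * c * `|y - z| ^+ 2 <= g y) ->
  unique (argmin C g) z.
Proof.
move=> c0 Cz zP; split.
  split=> // y /zP; apply: le_trans; rewrite lerDl.
  by rewrite mulr_ge0// ?exprn_ge0// mulr_ge0// ltW.
move=> y [Cy /(_ _ Cz) yz]; have := zP _ Cy => gzy.
have : c * `|y - z| ^+ 2 <= 0 by lra.
rewrite pmulr_rle0// => yz0.
have : `|y - z| ^+ 2 == 0 by rewrite eq_le yz0 exprn_ge0.
by rewrite sqrf_eq0 normr_eq0 subr_eq0 => /eqP.
Qed.

End StronglyConvexMinimization.

(** * Riesz representation and the gradient inequality *)

Section Gradient.
Context (R : realType) (H : completeNormedModType R) (ip : {dot H for idfun}).
Context (norm_ip : forall y : H, `|y| ^+ 2 = ip y y).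

(* The representer of L is the minimizer of h |-> |h|^2 / 2 - L h. *)
Lemma riesz_representation (L : {linear H -> R^o}) :
  continuous L -> exists g, forall h, L h = ip g h.
Proof.
move=> cL; have [k k0 Lk] := linear_lipschitz cL.
have LD (u v : H) : (L (u + v) : R) = L u + L v by rewrite linearD.
have LZ (a : R) (u : H) : (L (a *: u) : R) = a * L u by rewrite linearZ.
pose J (h : H) : R := `|h| ^+ 2 / 2 - L h.
have cJ : continuous J.
  move=> h; apply: cvgB; last exact: cL.
  apply: cvgM; last exact: cvg_cst.
  by apply: cvgM; apply: cvg_norm; exact: cvg_id.
have lbJ : has_lbound (J @` [set: H]).
  exists (- (k ^+ 2 / 2)) => _ [h _ <-]; rewrite /J.
  have Lh : L h <= k * `|h| := le_trans (ler_norm _) (Lk h).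
  have sq : 0 <= (`|h| - k) ^+ 2 by exact: sqr_ge0.
  by nra.
(* [8^-1] is half of the 1/4 in [sqr_norm_mid]; the linear part of [J] contributes nothing. *)
have [g _ gP] : exists2 g, [set: H] g &
    forall y, [set: H] y -> J g + 2 * (8^-1) * `|y - g| ^+ 2 <= J y.
  apply: strongly_convex_argmin => //; [by exists 0|].
  move=> u v _ _; split=> //; rewrite /J (sqr_norm_mid norm_ip).
  by rewrite LZ LD; lra.
exists g => h; apply/eqP; rewrite -subr_eq0.
pose d : R := L h - ip g h; rewrite -/d; apply/negPn/negP => d0.
(* Minimality of [g] against [g + r *: h]. A term linear in [r] dominated by a quadratic one must
   vanish: [r = d / (b + 1)] gives the contradiction, the added 1 keeping the denominator positive
   when [h = 0]. *)
have Jr (r : R) : r * d <= r ^+ 2 * (`|h| ^+ 2 / 2).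
  have := gP (g + r *: h) Logic.I; rewrite [g + _ - g]addrAC subrr add0r.
  rewrite /J (sqr_normD norm_ip g) (sqr_normZ norm_ip) LD LZ ipZr => gr.
  have h0 : 0 <= `|r *: h| ^+ 2 by exact: exprn_ge0.
  by move: h0; rewrite (sqr_normZ norm_ip) /d => h0; lra.
pose b : R := `|h| ^+ 2 / 2.
have b0 : 0 <= b by rewrite divr_ge0// exprn_ge0.
have := Jr (d / (b + 1)); rewrite -/b => Jd.
have b1 : 0 < b + 1 by rewrite ltr_wpDl.
have d2 : 0 < d ^+ 2 by rewrite exprn_even_gt0.
have d2b : 0 < d ^+ 2 / (b + 1) by rewrite divr_gt0.
have Jd' : d ^+ 2 / (b + 1) <= d ^+ 2 / (b + 1) * (b / (b + 1)).
  by move: Jd; rewrite expr_div_n; congr (_ <= _); field; rewrite gt_eqF.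
move: Jd'; rewrite ler_pMr// ler_pdivlMr// mul1r => ?.
by lra.
Qed.

Context (f : H -> R) (f_diff : forall y : H, differentiable f y).

Lemma diff_gradient y h : 'd f y h = ip (gradient ip f y) h.
Proof.
have [g gP] := riesz_representation (diff_continuous (f_diff y)).
rewrite /gradient; set G := (X in get X).
by have -> : 'd f y h = ip (get G) h by apply: (@getPex _ G); exists g.
Qed.

Lemma is_derive_comp_gradient (x : R -> H) (s : R) (x' : H) :
  is_derive s (1 : R) x x' ->
  is_derive s (1 : R) (f \o x) (ip (gradient ip f (x s)) x').
Proof.
move=> [dx <-]; have dfx : differentiable x s by apply/derivable1_diffP.
apply: DeriveDef; first by apply/derivable1_diffP/differentiable_comp.
rewrite deriveE; last exact: differentiable_comp.
by rewrite diff_comp//= -diff_gradient [in RHS]deriveE.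
Qed.

Context (f_convex : convex_function (setT : set (convex_lmodType H)) f).

Lemma convexE (t : R) u v : 0 <= t <= 1 ->
  f (t *: u + (1 - t) *: v) <= t * f u + (1 - t) * f v.
Proof.
move=> t01.
have [s st] : exists s : {i01 R}, s%:num = t.
  by exists (Itv01 (andP t01).1 (andP t01).2).
have := f_convex s (in_setT (u : convex_lmodType H)) (in_setT (v : convex_lmodType H)).
rewrite convRE /conv/= /unstable.onem st; exact.
Qed.

Lemma convex_mid u v : f (2^-1 *: (u + v)) <= (f u + f v) / 2.
Proof.
have half : 0 <= (2^-1 : R) <= 1 by lra.
have := convexE u v half.
rewrite (_ : 1 - 2^-1 = 2^-1 :> R); last by field.
by rewrite -scalerDr => ?; lra.
Qed.

(** For steps in ]0, 1[ convexity bounds the difference quotient of [f] from [u] towards [v] by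
    [f v - f u]; the right limit is the directional derivative. *)
Lemma convex_gradient_le u v : f u + ip (gradient ip f u) (v - u) <= f v.
Proof.
rewrite -diff_gradient -deriveE// -lerBrDl.
have df : derivable f u (v - u) by exact: diff_derivable.
rewrite /derive cvg_at_rightE//; apply: limr_le.
  by apply/cvg_ex; eexists; apply: cvg_dnbhs_at_right; exact: df.
near=> h.
have h0 : 0 < h by near: h; exact: nbhs_right_gt.
have h1 : h < 1 by near: h; exact: nbhs_right_lt.
rewrite /GRing.scale/= ler_pdivrMl//.
have -> : h *: (v - u) + u = h *: v + (1 - h) *: u.
  by rewrite scalerBr scalerBl scale1r addrAC addrA.
have h01 : 0 <= h <= 1 by rewrite !ltW.
by have := convexE v u h01 => ?; lra.
Unshelve. all: by end_near. Qed.

End Gradient.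

(** * The curve of minimizers of the regularized functions *)

Section TikhonovCurve.
Context (R : realType) (H : completeNormedModType R) (ip : {dot H for idfun}).
Context (norm_ip : forall y : H, `|y| ^+ 2 = ip y y).
Context (f : H -> R) (f_cont : continuous f).
Context (f_mid : forall u v, f (2^-1 *: (u + v)) <= (f u + f v) / 2).

(** Minimality and quadratic growth in one inequality. The constant [e / 4], half of the sharp one,
    is what the midpoint argument yields. *)
Definition tikhonov_curve (z : R -> H) := forall e : R, 0 < e -> forall y,
  f (z e) + e / 2 * `|z e| ^+ 2 + e / 4 * `|y - z e| ^+ 2 <=
  f y + e / 2 * `|y| ^+ 2.

Lemma tikhonov_curve_exists : argmin setT f !=set0 -> exists z, tikhonov_curve z.
Proof.
move=> [xs [_ xs_min]].
suff ex (e : R) : exists z : H, 0 < e -> forall y,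
    f z + e / 2 * `|z| ^+ 2 + e / 4 * `|y - z| ^+ 2 <= f y + e / 2 * `|y| ^+ 2.
  by have [z zP] := choice ex; exists z.
(* For [e <= 0] the implication is void and 0 is a placeholder. *)
have [e0|] := ltP 0 e; last by exists 0 => ?.
pose g (y : H) : R := f y + e / 2 * `|y| ^+ 2.
have cg : continuous g.
  move=> h; apply: cvgD; first exact: f_cont.
  apply: cvgM; first exact: cvg_cst.
  by apply: cvgM; apply: cvg_norm; exact: cvg_id.
have [z _ zP] : exists2 z, [set: H] z &
    forall y, [set: H] y -> g z + 2 * (e / 8) * `|y - z| ^+ 2 <= g y.
  apply: strongly_convex_argmin => //; [by rewrite divr_gt0|by exists 0| |].
    exists (f xs) => _ [h _ <-]; rewrite /g; apply: (le_trans (xs_min h I)).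
    by rewrite lerDl mulr_ge0 ?exprn_ge0// ltW// divr_gt0.
  move=> u v _ _; split=> //; rewrite /g (sqr_norm_mid norm_ip).
  by have := f_mid u v => ?; lra.
exists z => _ y; have := zP y Logic.I; rewrite /g => ?; lra.
Qed.

Context (z : R -> H) (zP : tikhonov_curve z).

Lemma tikhonov_unique (e : R) : 0 < e ->
  unique (argmin setT (fun y => f y + e / 2 * `|y| ^+ 2)) (z e).
Proof.
move=> e0; apply: (@argmin_uniq _ _ _ _ (e / 8)) => //; first by rewrite divr_gt0.
by move=> y _; have ? := zP e0 y; lra.
Qed.

Lemma tikhonov_norm_le (e : R) y : 0 < e -> argmin setT f y -> `|z e| <= `|y|.
Proof.
move=> e0 [_ ymin]; have zy := zP e0 y; have yz := ymin (z e) Logic.I.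
rewrite -(@ler_pXn2r _ 2) ?nnegrE//.
have d0 : 0 <= e / 4 * `|y - z e| ^+ 2 by rewrite mulr_ge0 ?exprn_ge0// ltW// divr_gt0.
have : e / 2 * `|z e| ^+ 2 <= e / 2 * `|y| ^+ 2 by lra.
by rewrite ler_pM2l// divr_gt0.
Qed.

(** Adding the growth inequalities at [e] and [e'], each tested at the other minimizer, cancels the
    values of [f]. *)
Lemma tikhonov_dist (e e' : R) : 0 < e' -> e' <= e ->
  (e + e') * `|z e' - z e| ^+ 2 <= 2 * (e - e') * (`|z e'| ^+ 2 - `|z e| ^+ 2).
Proof.
move=> e'0 ee'; have e0 : 0 < e := lt_le_trans e'0 ee'.
have h1 := zP e0 (z e'); have h2 := zP e'0 (z e).
by rewrite distrC in h2; lra.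
Qed.

(** In [tikhonov_dist] the ratio of [e - e'] to [e + e'] is at most 1. Norm increments thus control
    distances, which makes the curve Cauchy at 0. *)
Lemma tikhonov_sqr_dist (e e' : R) : 0 < e' -> e' <= e ->
  `|z e' - z e| ^+ 2 <= 2 * (`|z e'| ^+ 2 - `|z e| ^+ 2).
Proof.
move=> e'0; rewrite le_eqVlt => /predU1P[->|ee']; first by rewrite !subrr normr0 mulr0 expr0n.
have dd := tikhonov_dist e'0 (ltW ee').
have ee0 : 0 < e + e' by rewrite addr_gt0//; exact: lt_trans ee'.
have d0 : 0 <= (e + e') * `|z e' - z e| ^+ 2 by rewrite mulr_ge0 ?exprn_ge0// ltW.
have n0 : 0 <= `|z e'| ^+ 2 - `|z e| ^+ 2.
  by move: (le_trans d0 dd); rewrite pmulr_rge0// mulr_gt0// subr_gt0.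
have e'n : 0 <= e' * (`|z e'| ^+ 2 - `|z e| ^+ 2) by rewrite mulr_ge0// ltW.
by rewrite -(ler_pM2l ee0); lra.
Qed.

(** The difference of squared norms in [tikhonov_dist] factors and is at most 2 |xs| times the
    distance, by the triangle inequality and [tikhonov_norm_le]; one factor of the distance then
    cancels. *)
Lemma tikhonov_lipschitz (e e' : R) xs : argmin setT f xs -> 0 < e' -> e' <= e ->
  e * `|z e' - z e| <= 4 * `|xs| * (e - e').
Proof.
move=> xsmin e'0 ee'; have e0 : 0 < e := lt_le_trans e'0 ee'.
have n1 := tikhonov_norm_le e0 xsmin; have n2 := tikhonov_norm_le e'0 xsmin.
have dd := tikhonov_dist e'0 ee'.
have tri : `|z e'| - `|z e| <= `|z e' - z e| := lerB_dist _ _.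
have := normr_ge0 (z e' - z e); have := normr_ge0 (z e); have := normr_ge0 (z e').
move: (`|z e' - z e|) (`|z e|) (`|z e'|) (`|xs|) n1 n2 dd tri => d a b r ar br dd tri b0 a0 d0.
have [->|dn0] := eqVneq d 0; first by rewrite mulr0 !mulr_ge0// ?subr_ge0//; lra.
have dpos : 0 < d by rewrite lt0r dn0.
have e'd : 0 <= e' * d by rewrite mulr_ge0// ltW.
suff : (e + e') * d <= 4 * r * (e - e') by lra.
rewrite -(ler_pM2r dpos).
have : (b - a) * (b + a) <= d * (2 * r).
  apply: (@le_trans _ _ (d * (b + a))); first by rewrite ler_wpM2r// addr_ge0.
  by rewrite ler_wpM2l//; lra.
have ee0 : 0 <= 2 * (e - e') by rewrite mulr_ge0// subr_ge0.
move=> /(ler_wpM2l ee0) ?; lra.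
Qed.

Lemma tikhonov_continuous (e : R) : argmin setT f !=set0 -> 0 < e ->
  z e' @[e' --> e] --> z e.
Proof.
move=> [xs xsmin] e0; apply/cvgrPdist_le => d d0.
have r0 : 0 < 4 * `|xs| + 1 by rewrite ltr_wpDl// mulr_ge0.
have dr0 : 0 < e * d / (4 * `|xs| + 1) by rewrite divr_gt0// mulr_gt0.
near=> e'.
have e'0 : 0 < e' by near: e'; exact: lt_nbhsr.
have ee' : `|e - e'| * (4 * `|xs| + 1) <= e * d.
  by rewrite -ler_pdivlMr//; near: e'; apply: cvgr_dist_le => //; exact: cvg_id.
rewrite -(ler_pM2l e0); apply: le_trans ee'.
have [ele|/ltW ele] := leP e' e.
  have lip := tikhonov_lipschitz xsmin e'0 ele.
  by rewrite distrC ger0_norm ?subr_ge0//; lra.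
have lip := tikhonov_lipschitz xsmin e0 ele.
rewrite (distrC e) ger0_norm ?subr_ge0//.
apply: (@le_trans _ _ (e' * `|z e - z e'|)); first by rewrite ler_wpM2r.
by lra.
Unshelve. all: by end_near. Qed.

Lemma tikhonov_cvg : argmin setT f !=set0 -> exists2 xstar,
  unique (argmin (argmin setT f) (fun y : H => `|y|)) xstar &
  z e @[e --> 0^'+] --> xstar.
Proof.
move=> [xs xsmin].
pose N := [set `|z e| ^+ 2 | e in [set e : R | 0 < e]].
have supN : has_sup N.
  split; first by exists (`|z 1| ^+ 2); exists 1 => //=.
  by exists (`|xs| ^+ 2) => _ [e e0 <-]; rewrite ler_pXn2r ?nnegrE// tikhonov_norm_le.
have [l zl] : exists l : H, z e @[e --> (0 : R)^'+] --> l.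
  suff cz : cvg (z e @[e --> (0 : R)^'+]) by exists (lim (z e @[e --> (0 : R)^'+])).
  apply: cauchy_norm_cvg => d d0.
  (* At [e0] the squared norm is within [d ^+ 2 / 2] of its supremum, so for smaller [e] it grows by
     less than that; the factor 2 in [tikhonov_sqr_dist] restores [d ^+ 2]. *)
  have d2 : 0 < d ^+ 2 / 2 by rewrite divr_gt0// exprn_gt0.
  have [_ [e0 /= e00 <-] e0N] := sup_adherent d2 supN.
  exists e0; near=> e.
  have ep : 0 < e by near: e; exact: nbhs_right_gt.
  have ee0 : e <= e0 by near: e; exact: nbhs_right_le.
  have dd := tikhonov_sqr_dist ep ee0.
  have Ne : `|z e| ^+ 2 <= sup N by apply: ub_le_sup; [exact: supN.2|exists e].
  by rewrite distrC -(@ltr_pXn2r _ 2) ?nnegrE ?(ltW d0)//; lra.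
have l_le y : argmin setT f y -> `|l| <= `|y|.
  move=> ymin; apply: (cvgr_to_le (cvg_norm zl)).
  by near=> e; apply: tikhonov_norm_le => //; near: e; exact: nbhs_right_gt.
have lmin : argmin setT f l.
  split=> // y _; apply: le_trans (xsmin.2 y Logic.I).
  (* The minimality of [z e] tested at [xs] bounds this quantity by [f xs], and the regularization
     term disappears in the limit. *)
  have fz : f (z e) - e / 2 * `|xs| ^+ 2 @[e --> 0^'+] --> f l - 0 / 2 * `|xs| ^+ 2.
    apply: cvgB; first by apply: continuous_cvg => //; exact: f_cont.
    apply: cvgM; last exact: cvg_cst.
    by apply: cvgM; [exact: cvg_at_right_filter|exact: cvg_cst].
  move: fz; rewrite !mul0r subr0 => fz; apply: (cvgr_to_le fz).
  near=> e.
  have e0 : 0 < e by near: e; exact: nbhs_right_gt.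
  have ? := zP e0 xs; have ? : 0 <= e / 4 * `|xs - z e| ^+ 2.
    by rewrite mulr_ge0 ?exprn_ge0// ltW// divr_gt0.
  have ? : 0 <= e / 2 * `|z e| ^+ 2 by rewrite mulr_ge0 ?exprn_ge0// ltW// divr_gt0.
  by rewrite /=; lra.
exists l => //; split=> [|y [ymin yl]]; first by split=> // y; exact: l_le.
(* The midpoint of two minimizers of [f] is again one; if both have least norm, the parallelogram
   identity would make its norm smaller unless they coincide. *)
have mid : argmin setT f (2^-1 *: (l + y)).
  split=> // v _; apply: le_trans (f_mid _ _) _.
  have := lmin.2 v Logic.I; have := ymin.2 v Logic.I => ? ?; lra.
have : `|l| ^+ 2 <= `|2^-1 *: (l + y)| ^+ 2 by rewrite ler_pXn2r ?nnegrE// l_le.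
have : `|y| ^+ 2 <= `|l| ^+ 2 by rewrite ler_pXn2r ?nnegrE// yl.
rewrite (sqr_norm_mid norm_ip) => ? ?.
have ly : `|l - y| ^+ 2 <= 0 by lra.
have : `|l - y| ^+ 2 == 0 by rewrite eq_le ly exprn_ge0.
by rewrite sqrf_eq0 normr_eq0 subr_eq0 => /eqP.
Unshelve. all: by end_near. Qed.

End TikhonovCurve.

(** * One-sided derivatives and the barrier principle *)

Section RealLemmas.
Context (R : realType).

(** Serves the affine changes of variable in difference quotients, where the punctured neighbourhood
    must be kept. *)
Lemma inj_cvg_dnbhs (f : R -> R) (a : R) :
  f t @[t --> a] --> f a -> (forall t, f t = f a -> t = a) ->
  f t @[t --> a^'] --> (f a)^'.
Proof.
move=> cf inj A nA.
have fA : \forall t \near a, f t != f a -> A (f t) := cf _ nA.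
suff : \forall t \near a, t != a -> A (f t) by [].
apply: filterS fA => t /= At ta; apply: At.
by apply: contraNneq ta => /inj ->.
Qed.

(** Away from its endpoint the ray is a neighbourhood of [s], so the restriction in the limit is
    harmless. *)
Lemma is_derive_within_ray (H : normedModType R) (x : R -> H) (t0 s : R) (v : H) :
  t0 < s -> is_derive_within `[t0, +oo[%classic x s v -> is_derive s (1 : R) x v.
Proof.
move=> t0s xv.
have {}xv : (t - s)^-1 *: (x t - x s) @[t --> s^'] --> v.
  move=> A /xv; rewrite /= /within/= !nbhs_simpl/= => nA.
  have : \forall t \near s^', t0 < t by apply: nbhs_dnbhs; exact: lt_nbhsr.
  by apply: filterS2 nA => t tA t0t; apply: tA; rewrite /= in_itv/= andbT ltW.
have shift_cvg : (h *: (1 : R) + s) @[h --> (0 : R)^'] --> s^'.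
  have E : 0 *: (1 : R) + s = s by rewrite scale0r add0r.
  rewrite -[in s^']E; apply: (@inj_cvg_dnbhs (fun h : R => h *: (1 : R) + s)) => [|t /addIr].
    by apply: cvgD; [apply: cvgZr_tmp; exact: cvg_id|exact: cvg_cst].
  by rewrite scale0r [_ *: 1]mulr1.
have quot : h^-1 *: ((x \o shift s) (h *: (1 : R)) - x s) @[h --> (0 : R)^'] --> v.
  have := cvg_comp _ _ shift_cvg xv; apply: cvg_trans; apply: near_eq_cvg.
  by near=> h; rewrite /= addrK [h *: 1]mulr1.
by apply: DeriveDef; [apply/cvg_ex; exists v|exact: cvg_lim].
Unshelve. all: by end_near. Qed.

Lemma is_derive_lt0_right (g : R -> R) (s d : R) :
  is_derive s (1 : R) g d -> d < 0 -> \forall t \near s^'+, g t < g s.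
Proof.
move=> [dg <-] d0.
have shift_cvg : (t - s) @[t --> s^'] --> (0 : R)^'.
  rewrite -[in (0 : R)^'](subrr s).
  apply: (@inj_cvg_dnbhs (fun t : R => t - s)) => [|t /addIr//].
  by apply: cvgB; [exact: cvg_id|exact: cvg_cst].
have dq := cvg_dnbhs_at_right (cvg_comp _ _ shift_cvg dg).
near=> t.
have st : s < t by near: t; exact: nbhs_right_gt.
have : (t - s)^-1 *: (g ((t - s) *: 1 + s) - g s) < 0.
  by near: t; exact: (cvgr_lt _ dq _ d0).
by rewrite [_ *: 1]mulr1 subrK /GRing.scale/= pmulr_rlt0 ?subr_lt0// invr_gt0 subr_gt0.
Unshelve. all: by end_near. Qed.

(** If [h t > 0], the last point before [t] where [h <= 0] is a zero of [h] by continuity, and [h]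
    is positive just after it, against the crossing hypothesis. *)
Lemma barrier (h : R -> R) (T : R) :
  (forall s, T <= s -> h t @[t --> s] --> h s) -> h T <= 0 ->
  (forall s, T <= s -> h s = 0 -> \forall t \near s^'+, h t <= 0) ->
  forall t, T <= t -> h t <= 0.
Proof.
move=> ch hT hcross t Tt; apply/negP => /negP; rewrite -ltNge => ht.
pose A := [set s | [/\ T <= s, s <= t & h s <= 0]].
have supA : has_sup A by split; [exists T|exists t => s []].
pose s := sup A.
have Ts : T <= s by apply: ub_le_sup; [exact: supA.2|].
have st : s <= t by apply: ge_sup; [exact: supA.1|move=> r []].
have hs0 : h s <= 0.
  rewrite leNgt; apply/negP => hs.
  have [e /= e0 eP] := cvgr_gt _ (ch s Ts) _ hs.
  have [r [Tr rt hr] sr] := sup_adherent e0 supA.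
  have rs : r <= s by apply: ub_le_sup; [exact: supA.2|].
  have : 0 < h r by apply: eP; rewrite /= ger0_norm ?subr_ge0// ltrBlDr -ltrBlDl.
  by rewrite ltNge hr.
have hpos r : s < r -> r <= t -> 0 < h r.
  move=> sr rt; rewrite ltNge; apply/negP => hr.
  have : r <= s by apply: ub_le_sup; [exact: supA.2|split=> //; exact: le_trans (ltW sr)].
  by rewrite leNgt sr.
have slt : s < t.
  by rewrite lt_neqAle st andbT; apply: contraTneq ht => <-; rewrite -leNgt.
have hs : h s = 0.
  apply/eqP; rewrite eq_le hs0/=.
  apply: (@cvgr_to_ge _ (s^'+) _ _ h).
    by apply: cvg_at_right_filter; exact: ch.
  near=> r; apply/ltW/hpos; near: r; [exact: nbhs_right_gt|exact: nbhs_right_le].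
have : \forall r \near s^'+, False.
  near=> r; have : h r <= 0 by near: r; exact: hcross.
  apply/negP; rewrite -ltNge; apply: hpos; near: r; first exact: nbhs_right_gt.
  exact: nbhs_right_le.
by move=> /filter_ex[].
Unshelve. all: by end_near. Qed.

End RealLemmas.

(** * The algebraic inequality behind the energy decay *)

Section Dissipation.
Context (R : realType).

(* At a time s with u = x - z: A = |u|^2, B = |x'|^2, N = |x|^2, Z = |z|^2,
   C = <u, x'>, G1 = <u, grad f(x)>, G2 = <grad f(x), x'>, X1 = <u, x>,
   X2 = <x, x'>, F = f(x), fz = f(z), e = e(s), r = 1 / (s e(s)), and de, dW are
   the derivatives of e and W.  With K r e^2 = K e(s)/s, the last premise before W
   says that the energy touches the barrier. *)
Lemma dissipation_ineq (delta lam p rho c nu kap K e r F N A B C G1 G2 X1 X2 fz Z : R) :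
  0 < lam -> lam < delta -> lam * (delta - lam) <= 1 / 2 -> 0 < p -> 0 <= rho ->
  0 < c -> 4 * lam * c <= 1 -> 2 * c <= delta - lam ->
  0 < nu -> 16 * lam * rho * p * nu <= c ->
  0 < kap -> kap <= lam -> 2 * kap <= c ->
  0 < e -> 0 < r -> p * r <= c -> r <= 1 -> 2 * (1 + p / 2) * r <= kap ->
  2 * (p * rho ^+ 2 / 2 + 2 * lam * rho * p / nu) < kap * K ->
  0 <= A -> 0 <= B -> 0 <= N ->
  0 <= lam ^+ 2 * e ^+ 2 * A + 2 * lam * e * C + B ->
  0 <= lam ^+ 2 * e ^+ 2 * A - 2 * lam * e * C + B ->
  F - fz <= G1 -> 2 * X1 = N + A - Z ->
  0 <= F - fz + e ^+ 2 * (N - Z) / 2 ->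
  F - fz + e ^+ 2 * (N - Z) / 2 +
    (lam ^+ 2 * e ^+ 2 * A + 2 * lam * e * C + B) / 2 = K * r * e ^+ 2 ->
  forall W de dW : R,
  W = lam ^+ 2 * e ^+ 2 * A + 2 * lam * e * C + B ->
  de = - (p / 2) * r * e ^+ 2 ->
  dW = 2 * lam ^+ 2 * e * de * A + 2 * lam ^+ 2 * e ^+ 2 * C +
    2 * lam * de * C + 2 * lam * e * (B - delta * e * C - G1 - e ^+ 2 * X1) +
    2 * (- delta * e * B - G2 - e ^+ 2 * X2) ->
  G2 + e * de * N + e ^+ 2 * X2 - e * de * rho ^+ 2 + dW / 2 +
    2 * lam * rho * p * nu * e * W + 2 * lam * rho * p / nu * r ^+ 2 * e ^+ 3 +
    K * (1 + p / 2) * r ^+ 2 * e ^+ 3 < 0.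
Proof.
move=> lam0 lamd lamdd p0 rho0 c0 lamc cd nu0 nuc kap0 kapl kapc e0 r0 prc r1 qr
  KM A0 B0 N0 W0 V0 FG X1E Phi0 EE W de dW WE deE dWE.
pose Phi := F - fz + e ^+ 2 * (N - Z) / 2.
pose Y := lam ^+ 2 * e ^+ 2 * A + B.
have Y0 : 0 <= Y.
  by apply: addr_ge0 => //; rewrite mulr_ge0// mulr_ge0// sqr_ge0.
have {}X1E : X1 = (N + A - Z) / 2 by lra.
(* Strong convexity of the regularized function between x and z: beyond the gap [Phi] it yields
   [e ^+ 2 * A / 2], which is spent in [s6]. *)
have s1 : lam * e * (Phi + e ^+ 2 * A / 2) <= lam * e * (G1 + e ^+ 2 * X1).
  by apply: ler_wpM2l; [rewrite mulr_ge0// ltW|rewrite /Phi X1E; lra].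
have de0 : de <= 0.
  by rewrite deE !mulNr oppr_le0 !mulr_ge0 ?ltW// ?divr_gt0// exprn_gt0.
have s2 : e * de * N <= 0.
  by rewrite mulr_le0_ge0// mulr_ge0_le0// ltW.
have s3 : lam ^+ 2 * e * de * A <= 0.
  by rewrite mulr_le0_ge0// mulr_ge0_le0// mulr_ge0 ?sqr_ge0// ltW.
(* The cross terms of [dW / 2] combine to this multiple of [C]; the square [W0] trades [C] for [Y],
   here and in [s5]. *)
have s4 : - (lam * (delta - lam) * e ^+ 2 * C) <= (delta - lam) * e / 2 * Y.
  have k0 : 0 <= (delta - lam) * e / 2 by rewrite !mulr_ge0// ?subr_ge0 ltW.
  have := mulr_ge0 k0 W0; rewrite /Y => ?; lra.
have s5 : lam * de * C <= c / 4 * (e * Y).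
  have k0 : 0 <= p * r * e / 4 by rewrite !mulr_ge0// ltW.
  apply: (@le_trans _ _ (p * r * e / 4 * Y)).
    by have := mulr_ge0 k0 W0; rewrite /Y deE => ?; lra.
  have eY : 0 <= e * Y by rewrite mulr_ge0// ltW.
  have := ler_wpM2r eY prc => ?; lra.
(* Friction pays for the [B] part of [Y], the surplus of [s1] for its [A] part. This step dictates
   the bounds linking [lam], [delta] and [c]. *)
have s6 : - (delta - lam) * e * B + (delta - lam) * e / 2 * Y
    - lam * e * (e ^+ 2 * A / 2) <= - (c * (e * Y)).
  have eB : 0 <= e * B by rewrite mulr_ge0// ltW.
  have eA : 0 <= e ^+ 3 * A by rewrite mulr_ge0// exprn_ge0// ltW.
  have lA : 0 <= lam * (e ^+ 3 * A) by rewrite mulr_ge0// ltW.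
  have t1 := ler_wpM2r eB cd.
  have t2 := ler_wpM2r lA lamdd.
  have t3 := ler_wpM2r lA lamc.
  rewrite /Y; lra.
(* The square [V0] gives [W <= 2 * Y]. *)
have s7 : 2 * lam * rho * p * nu * e * W <= c / 4 * (e * Y).
  have k0 : 0 <= 2 * lam * rho * p * nu * e by rewrite !mulr_ge0// ltW.
  have := mulr_ge0 k0 V0.
  have eY : 0 <= e * Y by rewrite mulr_ge0// ltW.
  have := ler_wpM2r eY nuc; rewrite WE /Y => ? ?; lra.
(* [s5] and [s7] each cost [c / 4], so [c / 2] of the decay in [Y] is left; with the decay in [Phi]
   it dominates [kap * e] times the energy, which equals its barrier value. *)
have s8 : kap * e * (K * r * e ^+ 2) <= lam * e * Phi + c / 2 * (e * Y).
  rewrite -EE -/Phi.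
  have ePhi : 0 <= e * Phi by rewrite mulr_ge0// ltW.
  have eY : 0 <= e * Y by rewrite mulr_ge0// ltW.
  have ke : 0 <= kap * e by rewrite mulr_ge0// ltW.
  have t1 := ler_wpM2r ePhi kapl.
  have t2 := ler_wpM2r eY kapc.
  have t3 := mulr_ge0 ke V0.
  rewrite /Y in t2 *; lra.
(* All remaining terms are compared with [r * e ^+ 3]: half of [kap * K] absorbs the slope of the
   barrier, the other half beats the forcing. *)
have re0 : 0 < r * e ^+ 3 by rewrite mulr_gt0// exprn_gt0.
have K0 : 0 < K.
  rewrite -(pmulr_rgt0 _ kap0); apply: le_lt_trans KM.
  by rewrite mulr_ge0// addr_ge0// !mulr_ge0 ?sqr_ge0 ?invr_ge0// ltW.
have s9 : 2 * lam * rho * p / nu * r ^+ 2 * e ^+ 3 <= 2 * lam * rho * p / nu * (r * e ^+ 3).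
  have k0 : 0 <= 2 * lam * rho * p / nu * (r * e ^+ 3).
    by rewrite mulr_ge0 ?(ltW re0)// !mulr_ge0 ?invr_ge0// ltW.
  have := ler_wpM2l k0 r1 => ?; lra.
have s10 : K * (1 + p / 2) * r ^+ 2 * e ^+ 3 <= kap * K / 2 * (r * e ^+ 3).
  have k0 : 0 <= K * (r * e ^+ 3) by rewrite mulr_ge0// ltW.
  have := ler_wpM2l k0 qr => ?; lra.
have s11 : (p * rho ^+ 2 / 2 + 2 * lam * rho * p / nu) * (r * e ^+ 3) <
    kap * K / 2 * (r * e ^+ 3) by rewrite ltr_pM2r//; lra.
have s12 : - (e * de * rho ^+ 2) = p * rho ^+ 2 / 2 * (r * e ^+ 3) by rewrite deE; ring.
rewrite dWE.
move: s1 s2 s3 s4 s5 s6 s7 s8 s9 s10 s11 s12.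
move: (2 * lam * rho * p / nu) => M.
clear -R; clearbody Y Phi; move=> *; lra.
Qed.

End Dissipation.

(** * Derivatives of powers and of the energy with frozen reference point *)

Section RealDerivatives.
Context (R : realType).
Implicit Types (f g : R -> R) (s : R).

Lemma is_derive_ext f g s (df dg : R) :
  is_derive s (1 : R) g dg -> f =1 g -> df = dg -> is_derive s (1 : R) f df.
Proof. by move=> Dg /funext -> ->. Qed.

Lemma is_derive_mul f g s (df dg : R) :
  is_derive s (1 : R) f df -> is_derive s (1 : R) g dg ->
  is_derive s (1 : R) (fun t => f t * g t) (df * g s + f s * dg).
Proof.
move=> Df Dg; apply: (is_derive_eq (is_deriveM Df Dg)).
by rewrite /GRing.scale/=; ring.
Qed.

Lemma is_derive_add f g s (df dg : R) :
  is_derive s (1 : R) f df -> is_derive s (1 : R) g dg ->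
  is_derive s (1 : R) (fun t => f t + g t) (df + dg).
Proof. exact: is_deriveD. Qed.

Lemma is_derive_scale (k : R) f s (df : R) :
  is_derive s (1 : R) f df -> is_derive s (1 : R) (fun t => k * f t) (k * df).
Proof.
move=> Df; apply: (is_derive_eq (is_derive_mul (is_derive_cst k s 1) Df)).
by rewrite mul0r add0r.
Qed.

Lemma is_derive_powR_opp (a s : R) : 0 < s ->
  is_derive s (1 : R) (fun t => t `^ (- a)) (- a * s `^ (- a) / s).
Proof.
move=> s0; apply: (is_derive_eq (is_derive1_powR (- a) s0)).
rewrite powRB; last by apply/implyP => _; rewrite gt_eqF.
by rewrite powRr1 ?mulrA// ltW.
Qed.

(** Scalar form of [majorant]: [F], [N], [A], [C], [B] stand for f(x), |x|^2, |x - z_s|^2, <x - z_s,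
    x'>, |x'|^2. As [b] vanishes at [s], the drift terms contribute only through its derivative, and
    [b ^+ 2] not at all. *)
Lemma is_derive_majorant (F N A C B e : R -> R) (s dF dN dA dC dB de : R)
    (m rho lam th K : R) :
  0 < s -> 0 < e s -> 0 < th ->
  is_derive s (1 : R) F dF -> is_derive s (1 : R) N dN ->
  is_derive s (1 : R) A dA -> is_derive s (1 : R) C dC ->
  is_derive s (1 : R) B dB -> is_derive s (1 : R) e de ->
  let W t := lam ^+ 2 * e t ^+ 2 * A t + 2 * lam * e t * C t + B t in
  let b t := 4 * lam * rho * (e t - e t ^+ 3 / e s ^+ 2) in
  let dW := 2 * lam ^+ 2 * e s * de * A s + lam ^+ 2 * e s ^+ 2 * dA +
    2 * lam * de * C s + 2 * lam * e s * dC + dB in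
  is_derive s (1 : R)
   (fun t => F t + e t ^+ 2 * N t / 2 - m + (e s ^+ 2 - e t ^+ 2) / 2 * rho ^+ 2 +
     (W t + th * (W t * b t) + b t / th + b t ^+ 2) / 2 - K * (e t / t))
   (dF + e s * de * N s + e s ^+ 2 * dN / 2 - e s * de * rho ^+ 2 + dW / 2
     - 4 * lam * rho * de * (th * W s + th^-1) - K * (de / s - e s / s ^+ 2)).
Proof.
move=> s0 es0 th0 DF DN DA DC DB De W b dW.
have D2 : is_derive s (1 : R) (fun t => e t ^+ 2) (2 * e s * de).
  by apply: (is_derive_eq (is_derive_mul De De)); ring.
have D3 : is_derive s (1 : R) (fun t => e t ^+ 3) (3 * e s ^+ 2 * de).
  by apply: (is_derive_eq (is_derive_mul De D2)); ring.
have DW : is_derive s (1 : R) W dW.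
  have D := is_derive_add (is_derive_add (is_derive_scale (lam ^+ 2) (is_derive_mul D2 DA))
    (is_derive_scale (2 * lam) (is_derive_mul De DC))) DB.
  by apply: (is_derive_ext D) => [t|]; rewrite ?/W ?/dW; ring.
have bs : b s = 0 by rewrite /b; field; rewrite gt_eqF.
have Db : is_derive s (1 : R) b (- 8 * lam * rho * de).
  have D := is_derive_scale (4 * lam * rho)
    (is_derive_add De (is_derive_scale (- (e s ^+ 2)^-1) D3)).
  apply: (is_derive_ext D) => [t|]; first by rewrite /b; ring.
  by field; rewrite gt_eqF.
have Dinv : is_derive s (1 : R) (fun t => e t / t) (de / s - e s / s ^+ 2).
  have DV : is_derive s (1 : R) (fun t : R => t^-1) (- (s ^+ 2)^-1).
    have sn : (id : R -> R) s != 0 by rewrite gt_eqF.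
    apply: (is_derive_eq (is_deriveV sn (is_derive_id s 1))).
    by rewrite /GRing.scale/= mulr1.
  by apply: (is_derive_eq (is_derive_mul De DV)); ring.
have D := is_derive_add (is_derive_add (is_derive_add (is_derive_add DF
    (is_derive_scale 2^-1 (is_derive_mul D2 DN)))
    (is_derive_scale (- (rho ^+ 2 / 2)) D2))
  (is_derive_scale 2^-1 (is_derive_add (is_derive_add (is_derive_add DW
    (is_derive_scale th (is_derive_mul DW Db))) (is_derive_scale th^-1 Db))
    (is_derive_mul Db Db)))) (is_derive_add (is_derive_scale (- K) Dinv)
    (is_derive_cst (e s ^+ 2 / 2 * rho ^+ 2 - m) s 1)).
apply: (is_derive_ext D) => [t|]; rewrite /cst/=.
  by ring.
by rewrite bs; field; rewrite !gt_eqF.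
Qed.

Lemma powR_opp_small (a eta : R) : 0 < a -> 0 < eta ->
  exists T, 0 < T /\ forall t, T <= t -> t `^ (- a) <= eta.
Proof.
move=> a0 eta0; exists (eta^-1 `^ a^-1); split; first by rewrite powR_gt0// invr_gt0.
move=> t Tt; rewrite powRN.
have t0 : 0 < t by apply: lt_le_trans Tt; rewrite powR_gt0// invr_gt0.
rewrite -[leRHS]invrK lef_pV2 ?posrE ?invr_gt0 ?powR_gt0//.
rewrite -[leLHS]powRr1 ?invr_ge0 ?(ltW eta0)// -[X in _ `^ X](@mulVf _ a) ?gt_eqF//.
by rewrite powRrM (ge0_ler_powR (ltW a0))// nnegrE ?powR_ge0// (ltW t0).
Qed.

End RealDerivatives.

(** * Energy estimates along the trajectory *)

Section Trajectory.
Context (R : realType) (H : completeNormedModType R) (ip : {dot H for idfun}).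
Context (norm_ip : forall y : H, `|y| ^+ 2 = ip y y).
Context (f : H -> R) (f_diff : forall y : H, differentiable f y).
Context (f_convex : convex_function (setT : set (convex_lmodType H)) f).
Context (z : R -> H) (zP : tikhonov_curve f z).
Context (xs : H) (xs_min : argmin setT f xs).
Context (t0 delta p : R) (t0_gt0 : 0 < t0) (delta_gt0 : 0 < delta)
  (p_gt0 : 0 < p) (p_lt2 : p < 2).
Context (x x' x'' : R -> H).
Let e (t : R) := t `^ (- (p / 2)).
Context (Dx : forall t, t0 < t -> is_derive t (1 : R) x (x' t)).
Context (Dx' : forall t, t0 < t -> is_derive t (1 : R) x' (x'' t)).
Context (ode : forall t, t0 < t ->
  x'' t = - (delta * e t) *: x' t - gradient ip f (x t) - (e t ^+ 2) *: x t).

Definition energy (lam t : R) : R :=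
  f (x t) + e t ^+ 2 * `|x t| ^+ 2 / 2
  - (f (z (e t ^+ 2)) + e t ^+ 2 / 2 * `|z (e t ^+ 2)| ^+ 2)
  + `|(lam * e t) *: (x t - z (e t ^+ 2)) + x' t| ^+ 2 / 2.

Lemma e_gt0 t : t0 < t -> 0 < e t.
Proof. by move=> t0t; rewrite powR_gt0//; exact: lt_trans t0t. Qed.

Lemma e_nincr s t : t0 < s -> s <= t -> e t <= e s.
Proof.
move=> t0s st; have s0 := lt_trans t0_gt0 t0s; have tp := lt_le_trans s0 st.
have p2 : 0 <= p / 2 by rewrite divr_ge0// ltW.
rewrite /e !powRN lef_pV2 ?posrE ?powR_gt0//.
by rewrite (ge0_ler_powR p2)// nnegrE ltW.
Qed.

Lemma is_derive_e s : t0 < s -> is_derive s (1 : R) e (- (p / 2) * e s / s).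
Proof. by move=> t0s; apply: is_derive_powR_opp; exact: lt_trans t0s. Qed.

Lemma is_derive_continuous (V : normedModType R) (g : R -> V) (s : R) (dg : V) :
  is_derive s (1 : R) g dg -> g t @[t --> s] --> g s.
Proof. by case=> dgs _; apply/differentiable_continuous/derivable1_diffP. Qed.

Lemma energy_continuous lam s : t0 < s -> energy lam t @[t --> s] --> energy lam s.
Proof.
move=> t0s.
have cx := is_derive_continuous (Dx t0s); have cx' := is_derive_continuous (Dx' t0s).
have ce := is_derive_continuous (is_derive_e t0s).
have fc y : {for y, continuous f} := differentiable_continuous (f_diff y).
have ce2 : e t ^+ 2 @[t --> s] --> e s ^+ 2 by apply: cvgM.
have e20 : 0 < e s ^+ 2 by rewrite exprn_gt0// e_gt0.
have cz : z (e t ^+ 2) @[t --> s] --> z (e s ^+ 2).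
  by apply: (cvg_comp _ _ ce2); apply: (tikhonov_continuous zP) => //; exists xs.
have sq (g : R -> H) v : g t @[t --> s] --> v -> `|g t| ^+ 2 @[t --> s] --> `|v| ^+ 2.
  by move=> gv; apply: cvgM; exact: cvg_norm.
have fcomp (g : R -> H) v : g t @[t --> s] --> v -> f (g t) @[t --> s] --> f v.
  by move=> gv; apply: continuous_cvg => //; exact: fc.
apply: cvgD.
  apply: cvgB; apply: cvgD; try exact: fcomp.
    by apply: cvgM; [apply: cvgM => //; exact: sq|exact: cvg_cst].
  by apply: cvgM; [apply: cvgM => //; exact: cvg_cst|exact: sq].
apply: cvgM; last exact: cvg_cst.
apply: sq; apply: cvgD => //; apply: cvgZ; last exact: cvgB.
by apply: cvgM => //; exact: cvg_cst.
Qed.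

(* The reference point is frozen at time s: z moves slower than e^2, so the
   energy lies below this function of t, which is differentiable although z
   need not be. *)
Definition majorant (lam th K s t : R) : R :=
  let y t := x t - z (e s ^+ 2) in
  let W t := lam ^+ 2 * e t ^+ 2 * ip (y t) (y t) +
    2 * lam * e t * ip (y t) (x' t) + ip (x' t) (x' t) in
  let b t := 4 * lam * `|xs| * (e t - e t ^+ 3 / e s ^+ 2) in
  f (x t) + e t ^+ 2 * ip (x t) (x t) / 2
  - (f (z (e s ^+ 2)) + e s ^+ 2 / 2 * `|z (e s ^+ 2)| ^+ 2)
  + (e s ^+ 2 - e t ^+ 2) / 2 * `|xs| ^+ 2 +
  (W t + th * (W t * b t) + b t / th + b t ^+ 2) / 2 - K * (e t / t).

(** Testing the minimality of z_s at z_t bounds the change of the minimal value; by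
    [tikhonov_lipschitz], [b] dominates the displacement inside the velocity term. *)
Lemma energy_le_majorant lam th K s t : 0 < lam -> 0 < th -> t0 < s -> s <= t ->
  energy lam t - K * (e t / t) <= majorant lam th K s t.
Proof.
move=> lam0 th0 t0s st; have t0t := lt_le_trans t0s st.
have es0 := e_gt0 t0s; have et0 := e_gt0 t0t; have ets := e_nincr t0s st.
have es2 : 0 < e s ^+ 2 by rewrite exprn_gt0.
have et2 : 0 < e t ^+ 2 by rewrite exprn_gt0.
have ets2 : e t ^+ 2 <= e s ^+ 2 by rewrite ler_pXn2r ?nnegrE ?(ltW et0) ?(ltW es0).
have ztn : `|z (e t ^+ 2)| ^+ 2 <= `|xs| ^+ 2.
  by rewrite ler_pXn2r ?nnegrE// (tikhonov_norm_le zP).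
have lip := tikhonov_lipschitz zP xs_min et2 ets2.
have val := zP es2 (z (e t ^+ 2)).
rewrite /energy /majorant.
set y := x t - z (e s ^+ 2); set W := _ + _ + ip (x' t) (x' t).
set b := 4 * _ * _ * _.
set dz := z (e t ^+ 2) - z (e s ^+ 2) in lip val *.
have wE : (lam * e t) *: (x t - z (e t ^+ 2)) + x' t =
    ((lam * e t) *: y + x' t) - (lam * e t) *: dz.
  by rewrite addrAC -scalerBr /y /dz opprB addrA subrK.
set w := (lam * e t) *: y + x' t in wE.
have WE : W = `|w| ^+ 2.
  by rewrite /w (sqr_normD norm_ip) (sqr_normZ norm_ip) ipZl /W -!norm_ip; ring.
have bdz : `|(lam * e t) *: dz| <= b.
  have le0 : 0 < lam * e t by rewrite mulr_gt0.
  have -> : b = lam * e t / e s ^+ 2 * (4 * `|xs| * (e s ^+ 2 - e t ^+ 2)).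
    by rewrite /b; field; rewrite gt_eqF.
  rewrite normrZ (gtr0_norm le0) -mulrA ler_pM2l// -ler_pdivrMl ?invr_gt0// invrK.
  exact: lip.
have b0 : 0 <= b := le_trans (normr_ge0 _) bdz.
have vle : `|w - (lam * e t) *: dz| ^+ 2 <= (`|w| + b) ^+ 2.
  rewrite ler_pXn2r ?nnegrE// ?addr_ge0//.
  by apply: le_trans (ler_normB _ _) _; rewrite lerD2l.
(* Young's inequality with weight [th] removes |w|, which need not be differentiable where it
   vanishes, in favour of its square [W]. *)
have young : 2 * `|w| * b <= th * (W * b) + b / th.
  have sq : 0 <= (th * `|w| - 1) ^+ 2 * (b / th).
    by rewrite mulr_ge0 ?sqr_ge0// divr_ge0// ltW.
  rewrite -subr_ge0 WE; apply: (le_trans sq); rewrite le_eqVlt; apply/orP; left.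
  by apply/eqP; field; rewrite gt_eqF.
have mval : - (f (z (e t ^+ 2)) + e t ^+ 2 / 2 * `|z (e t ^+ 2)| ^+ 2) <=
    - (f (z (e s ^+ 2)) + e s ^+ 2 / 2 * `|z (e s ^+ 2)| ^+ 2) +
    (e s ^+ 2 - e t ^+ 2) / 2 * `|xs| ^+ 2.
  have d0 : 0 <= e s ^+ 2 / 4 * `|dz| ^+ 2 by rewrite mulr_ge0 ?exprn_ge0// divr_ge0// ltW.
  have es0' : 0 <= (e s ^+ 2 - e t ^+ 2) / 2 by rewrite divr_ge0// subr_ge0.
  have := ler_wpM2l es0' ztn => ?; lra.
rewrite wE -norm_ip.
by lra.
Qed.

Lemma majorant_diag lam th K s : 0 < th -> t0 < s ->
  majorant lam th K s s = energy lam s - K * (e s / s).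
Proof.
move=> th0 t0s; have es0 := e_gt0 t0s; have s0 := lt_trans t0_gt0 t0s.
rewrite /majorant /energy (sqr_normD norm_ip) (sqr_normZ norm_ip) ipZl -!norm_ip.
by field; rewrite !gt_eqF.
Qed.

(** The weight [th = nu * s] splits the drift into a multiple of [nu * e s * W], absorbed by
    dissipation, and a forcing of order e(s)/s^2. [dissipation_ineq] then makes the derivative at
    [s] negative. *)
Lemma majorant_decreasing (lam c nu kap K s : R) :
  0 < lam -> lam < delta -> lam * (delta - lam) <= 1 / 2 ->
  0 < c -> 4 * lam * c <= 1 -> 2 * c <= delta - lam ->
  0 < nu -> 16 * lam * `|xs| * p * nu <= c ->
  0 < kap -> kap <= lam -> 2 * kap <= c -> t0 < s ->
  let r := (s * e s)^-1 in
  p * r <= c -> r <= 1 -> 2 * (1 + p / 2) * r <= kap ->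
  2 * (p * `|xs| ^+ 2 / 2 + 2 * lam * `|xs| * p / nu) < kap * K ->
  energy lam s = K * (e s / s) ->
  \forall t \near s^'+, majorant lam (nu * s) K s t < majorant lam (nu * s) K s s.
Proof.
move=> lam0 lamd lamdd c0 lamc cd nu0 nuc kap0 kapl kapc t0s r pr r1 qr KM EK.
have s0 := lt_trans t0_gt0 t0s; have es0 := e_gt0 t0s.
have es2 : 0 < e s ^+ 2 by rewrite exprn_gt0.
pose z0 := z (e s ^+ 2); pose y t := x t - z0.
have Dy : is_derive s (1 : R) y (x' s).
  by apply: (is_derive_eq (is_deriveB (Dx t0s) (is_derive_cst z0 s 1))); rewrite subr0.
have Df := is_derive_comp_gradient norm_ip f_diff (Dx t0s).
have DN := is_derive_ip norm_ip (Dx t0s) (Dx t0s).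
have DA := is_derive_ip norm_ip Dy Dy.
have DC := is_derive_ip norm_ip Dy (Dx' t0s).
have DB := is_derive_ip norm_ip (Dx' t0s) (Dx' t0s).
have th0 : 0 < nu * s by rewrite mulr_gt0.
have DM := is_derive_majorant (f z0 + e s ^+ 2 / 2 * `|z0| ^+ 2) `|xs| lam K
  s0 es0 th0 Df DN DA DC DB (is_derive_e t0s).
apply: (is_derive_lt0_right DM) => {DM Df DN DA DC DB Dy}.
set de := - (p / 2) * e s / s.
have rpos : 0 < r by rewrite invr_gt0 mulr_gt0.
pose g := gradient ip f (x s).
have main := @dissipation_ineq R delta lam p `|xs| c nu kap K (e s) r (f (x s))
  (ip (x s) (x s)) (ip (y s) (y s)) (ip (x' s) (x' s)) (ip (y s) (x' s))
  (ip (y s) g) (ip g (x' s)) (ip (y s) (x s)) (ip (x s) (x' s)) (f z0) (ip z0 z0)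
  lam0 lamd lamdd p_gt0 (normr_ge0 _) c0 lamc cd nu0 nuc kap0 kapl kapc es0 rpos pr r1
  qr KM.
have ipyx'' : ip (y s) (x'' s) = - (delta * e s) * ip (y s) (x' s) -
    ip (y s) g - e s ^+ 2 * ip (y s) (x s) by rewrite ode// !(ipBr, ipZr).
have ipx'x'' : ip (x' s) (x'' s) = - (delta * e s) * ip (x' s) (x' s) -
    ip g (x' s) - e s ^+ 2 * ip (x s) (x' s).
  by rewrite ode// !(ipBr, ipZr) [ip (x' s) g]ipC [ip (x' s) (x s)]ipC.
rewrite [ip (x'' s) _]ipC [ip (x' s) (x s)]ipC [ip (x' s) (y s)]ipC ipyx'' ipx'x''.
have wW : lam ^+ 2 * e s ^+ 2 * ip (y s) (y s) + 2 * lam * e s * ip (y s) (x' s) +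
    ip (x' s) (x' s) = `|(lam * e s) *: y s + x' s| ^+ 2.
  by rewrite (sqr_normD norm_ip) (sqr_normZ norm_ip) ipZl -!norm_ip; ring.
have wV : lam ^+ 2 * e s ^+ 2 * ip (y s) (y s) - 2 * lam * e s * ip (y s) (x' s) +
    ip (x' s) (x' s) = `|(lam * e s) *: y s - x' s| ^+ 2.
  by rewrite (sqr_normB norm_ip) (sqr_normZ norm_ip) ipZl -!norm_ip; ring.
have grad_le : f (x s) - f z0 <= ip (y s) g.
  have := convex_gradient_le norm_ip f_diff f_convex (x s) z0.
  by rewrite -opprB ipC -scaleN1r ipZl -/(y s) -/g => ?; lra.
have yx : 2 * ip (y s) (x s) = ip (x s) (x s) + ip (y s) (y s) - ip z0 z0.
  by rewrite /y !ipE [ip z0 (x s)]ipC; ring.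
have Phi0 : 0 <= f (x s) - f z0 + e s ^+ 2 * (ip (x s) (x s) - ip z0 z0) / 2.
  have := zP es2 (x s); rewrite -/z0 -!norm_ip.
  have : 0 <= e s ^+ 2 / 4 * `|x s - z0| ^+ 2 by rewrite mulr_ge0 ?exprn_ge0// divr_ge0// ltW.
  by move=> ? ?; lra.
have EE : f (x s) - f z0 + e s ^+ 2 * (ip (x s) (x s) - ip z0 z0) / 2 +
    (lam ^+ 2 * e s ^+ 2 * ip (y s) (y s) + 2 * lam * e s * ip (y s) (x' s) +
     ip (x' s) (x' s)) / 2 = K * r * e s ^+ 2.
  have -> : K * r * e s ^+ 2 = K * (e s / s) by rewrite /r; field; rewrite !gt_eqF.
  by rewrite -EK wW /energy -/z0 -/(y s) -!norm_ip; field.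
have ip0 v : 0 <= ip v v by rewrite -norm_ip exprn_ge0.
have W0 : 0 <= lam ^+ 2 * e s ^+ 2 * ip (y s) (y s) + 2 * lam * e s * ip (y s) (x' s) +
    ip (x' s) (x' s) by rewrite wW exprn_ge0.
have V0 : 0 <= lam ^+ 2 * e s ^+ 2 * ip (y s) (y s) - 2 * lam * e s * ip (y s) (x' s) +
    ip (x' s) (x' s) by rewrite wV exprn_ge0.
have deE : de = - (p / 2) * r * e s ^+ 2 by rewrite /de /r; field; rewrite !gt_eqF.
have := main (ip0 _) (ip0 _) (ip0 _) W0 V0 grad_le yx Phi0 EE _ de _ erefl deE erefl.
apply: le_lt_trans; rewrite le_eqVlt; apply/orP; left; apply/eqP.
by rewrite -/g /de /r; field; rewrite !gt_eqF.
Qed.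

Lemma energy_bound : exists lam K T,
  t0 < T /\ forall t, T <= t -> energy lam t <= K * (e t / t).
Proof.
(* [delta / 2] keeps the residual friction [delta - lam] positive; the other bound gives
   [lam * delta <= 1 / 2]. *)
pose lam : R := Order.min (delta / 2) (1 / (2 * delta)).
have lam0 : 0 < lam by rewrite lt_min !divr_gt0 ?mulr_gt0.
have lamd2 : lam <= delta / 2 by rewrite ge_min lexx.
have lamd : lam < delta by lra.
have lamdd : lam * (delta - lam) <= 1 / 2.
  have h : lam <= 1 / (2 * delta) by rewrite ge_min lexx orbT.
  have {}h : lam * delta <= 1 / 2.
    have -> : 1 / 2 = 1 / (2 * delta) * delta by field; rewrite gt_eqF.
    by rewrite ler_pM2r.
  by have ? : 0 <= lam * lam := mulr_ge0 (ltW lam0) (ltW lam0); lra.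
pose c : R := Order.min (1 / (4 * lam)) ((delta - lam) / 2).
have c0 : 0 < c by rewrite lt_min !divr_gt0 ?mulr_gt0 ?subr_gt0.
have lamc : 4 * lam * c <= 1.
  have h : c <= 1 / (4 * lam) by rewrite ge_min lexx.
  by move: h; rewrite ler_pdivlMr ?mulr_gt0// mulrC.
have cd : 2 * c <= delta - lam.
  have h : c <= (delta - lam) / 2 by rewrite ge_min lexx orbT.
  by lra.
pose kap : R := Order.min lam (c / 2).
have kap0 : 0 < kap by rewrite lt_min lam0 divr_gt0.
have kapl : kap <= lam by rewrite ge_min lexx.
have kapc : 2 * kap <= c.
  have h : kap <= c / 2 by rewrite ge_min lexx orbT.
  by lra.
have q0 : 0 <= lam * `|xs| * p by rewrite !mulr_ge0// ltW.
(* The added 1 keeps the denominator positive even if [xs = 0]. *)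
pose nu : R := c / (16 * (lam * `|xs| * p + 1)).
have den0 : 0 < 16 * (lam * `|xs| * p + 1) by rewrite mulr_gt0// ltr_wpDl.
have nu0 : 0 < nu by rewrite divr_gt0.
have nuc : 16 * lam * `|xs| * p * nu <= c.
  have h : nu * (16 * (lam * `|xs| * p + 1)) = c by rewrite divfK// gt_eqF.
  by rewrite -[leRHS]h; lra.
(* Collects the smallness conditions on 1/(s e(s)) = s^(-(1 - p/2)), which tends to 0 because
   [p < 2]. *)
pose eta : R := Order.min (c / p) (Order.min 1 (kap / (2 * (1 + p / 2)))).
have q1 : 0 < 2 * (1 + p / 2) by rewrite mulr_gt0// addr_gt0// divr_gt0.
have eta0 : 0 < eta by rewrite !lt_min ltr01 !divr_gt0.
have p21 : 0 < 1 - p / 2 by rewrite subr_gt0 ltr_pdivrMr// mul1r.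
have [T [T0 TP]] := powR_opp_small p21 eta0.
pose M : R := 2 * (p * `|xs| ^+ 2 / 2 + 2 * lam * `|xs| * p / nu).
pose S : R := Order.max T (t0 + 1).
have t0S : t0 < S by rewrite lt_max ltrDl ltr01 orbT.
have S0 : 0 < S := lt_trans t0_gt0 t0S.
have eS : 0 < e S / S by rewrite divr_gt0// e_gt0.
(* The first entry makes [kap * K] exceed the forcing, the second starts the energy below the
   barrier at [S]. *)
pose K : R := Order.max ((M + 1) / kap) (energy lam S / (e S / S)).
have KM : M < kap * K.
  have h : (M + 1) / kap <= K by rewrite le_max lexx.
  by move: h; rewrite ler_pdivrMr// => ?; lra.
exists lam, K, S; split=> // t St; rewrite -subr_le0.
apply: (@barrier _ (fun t => energy lam t - K * (e t / t)) S) St.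
- move=> s Ss; have t0s := lt_le_trans t0S Ss; have s0 := lt_trans t0_gt0 t0s.
  apply: cvgB; first exact: energy_continuous.
  apply: cvgM; first exact: cvg_cst.
  apply: cvgM; first exact: (is_derive_continuous (is_derive_e t0s)).
  by apply: cvgV; [rewrite gt_eqF|exact: cvg_id].
- by rewrite subr_le0 -ler_pdivrMr// le_max lexx orbT.
move=> s Ss /eqP; rewrite subr_eq0 => /eqP Es.
have t0s := lt_le_trans t0S Ss; have s0 := lt_trans t0_gt0 t0s.
have es0 := e_gt0 t0s.
have Ts : T <= s by rewrite (le_trans _ Ss)// le_max lexx.
have r_le : (s * e s)^-1 <= eta.
  apply: le_trans (TP _ Ts); rewrite powRN.
  rewrite powRD; last by apply/implyP => _; rewrite gt_eqF.
  by rewrite powRr1// ltW.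
have r0 : 0 < (s * e s)^-1 by rewrite invr_gt0 mulr_gt0.
have r1 : p * (s * e s)^-1 <= c.
  by rewrite mulrC -ler_pdivlMr// (le_trans r_le)// ge_min lexx.
have r2 : (s * e s)^-1 <= 1 by rewrite (le_trans r_le)// !ge_min lexx orbT.
have r3 : 2 * (1 + p / 2) * (s * e s)^-1 <= kap.
  by rewrite mulrC -ler_pdivlMr// (le_trans r_le)// !ge_min lexx !orbT.
have dec := majorant_decreasing lam0 lamd lamdd c0 lamc cd nu0 nuc kap0 kapl kapc t0s
  r1 r2 r3 KM Es.
have nus : 0 < nu * s by rewrite mulr_gt0.
have maj0 : majorant lam (nu * s) K s s = 0 by rewrite majorant_diag// Es subrr.
near=> t'.
have st : s <= t' by near: t'; exact: nbhs_right_ge.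
apply: le_trans (energy_le_majorant K lam0 nus t0s st) _.
by rewrite -maj0; apply: ltW; near: t'.
Unshelve. all: by end_near. Qed.

Lemma energy_dist lam t : t0 < t ->
  e t ^+ 2 / 4 * `|x t - z (e t ^+ 2)| ^+ 2 <= energy lam t.
Proof.
move=> t0t; have e2 : 0 < e t ^+ 2 by rewrite exprn_gt0// e_gt0.
have v0 : 0 <= `|(lam * e t) *: (x t - z (e t ^+ 2)) + x' t| ^+ 2 by exact: exprn_ge0.
by have := zP e2 (x t); rewrite /energy => ?; lra.
Qed.

(** The minimal regularized value is at most the one at [xs]; the last term is the resulting
    bias. *)
Lemma energy_value lam t : t0 < t ->
  f (x t) - f xs <= energy lam t + e t ^+ 2 / 2 * `|xs| ^+ 2.
Proof.
move=> t0t; have e2 : 0 < e t ^+ 2 by rewrite exprn_gt0// e_gt0.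
have v0 : 0 <= `|(lam * e t) *: (x t - z (e t ^+ 2)) + x' t| ^+ 2 by exact: exprn_ge0.
have n0 : 0 <= e t ^+ 2 * `|x t| ^+ 2 := mulr_ge0 (ltW e2) (exprn_ge0 _ (normr_ge0 _)).
have d0 : 0 <= e t ^+ 2 / 4 * `|xs - z (e t ^+ 2)| ^+ 2.
  by apply: mulr_ge0; [rewrite ltW// divr_gt0|exact: exprn_ge0].
by have := zP e2 xs; rewrite /energy => ?; lra.
Qed.

End Trajectory.

(** * Conversion between powers of t *)

Section PowerRates.
Context (R : realType).

Lemma sqr_powR_opp_half (p t : R) : 0 < t -> (t `^ (- (p / 2))) ^+ 2 = 1 / t `^ p.
Proof.
move=> t0; rewrite expr2 -powRD; last by apply/implyP => _; rewrite gt_eqF.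
by rewrite (_ : _ + _ = - p) ?powRN ?div1r//; field.
Qed.

(** Dividing the energy rate e(t)/t by eps(t) = e(t)^2 gives the distance rate. *)
Lemma powR_opp_half_ratio (p t : R) : 0 < t ->
  t `^ (- (p / 2)) / t / (t `^ (- (p / 2))) ^+ 2 = t `^ (- ((2 - p) / 2)).
Proof.
move=> t0; have tp : 0 < t `^ (- (p / 2)) by rewrite powR_gt0.
have -> : - ((2 - p) / 2) = - (1 + - (p / 2)) by field.
rewrite [in RHS]powRN powRD; last by apply/implyP => _; rewrite gt_eqF.
by rewrite powRr1 ?(ltW t0)//; field; rewrite !gt_eqF.
Qed.

End PowerRates.

(** * Convergence rates and strong convergence of the trajectory *)

Theorem theorem3 (R : realType) (H : completeNormedModType R)
    (ip : {dot H for idfun})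
    (norm_ip : forall y : H, `|y| ^+ 2 = ip y y)
    (f : H -> R)
    (f_convex : convex_function (setT : set (convex_lmodType H)) f)
    (f_diff : forall y : H, differentiable f y)
    (f_lip : forall B : set H, bounded_set B ->
       [lipschitz gradient ip f y | y in B])
    (f_argmin : argmin setT f !=set0)
    (t0 delta p : R) (t0_gt0 : 0 < t0) (delta_gt0 : 0 < delta)
    (p_gt0 : 0 < p) (p_lt2 : p < 2)
    (x : R -> H)
    (x_sol : solution_trajectory ip f (fun t => delta / t `^ (p / 2))
               (fun t => 1 / t `^ p) t0 x) :
  [/\ (fun t : R => f (x t) - min_value f) =O_ (+oo) (fun t => 1 / t `^ p),
      exists xeps : R -> H,
        (forall t, t0 <= t ->
           unique (argmin setT
                     (fun y : H => f y + (1 / t `^ p) / 2 * `|y| ^+ 2))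
             (xeps t)) /\
        (fun t : R => `|x t - xeps t| ^+ 2) =O_ (+oo)
          (fun t => 1 / t `^ ((2 - p) / 2)) &
      exists xstar : H,
        unique (argmin (argmin setT f) (fun y : H => `|y|)) xstar /\
        x t @[t --> +oo] --> xstar].
Proof.
have f_cont : continuous f by move=> y; exact: differentiable_continuous.
have f_mid := convex_mid f_convex.
have [z zP] := tikhonov_curve_exists norm_ip f_cont f_mid f_argmin.
have [xs xs_min] := f_argmin.
have [x' [x'' [xx' x'x'' _ ode]]] := x_sol.
have I_t t : t0 < t -> `[t0, +oo[%classic t by move=> t0t; rewrite /= in_itv/= andbT ltW.
have Dx t : t0 < t -> is_derive t (1 : R) x (x' t).
  by move=> t0t; apply: (is_derive_within_ray t0t); exact/xx'/I_t.
have Dx' t : t0 < t -> is_derive t (1 : R) x' (x'' t).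
  by move=> t0t; apply: (is_derive_within_ray t0t); exact/x'x''/I_t.
pose e (t : R) : R := t `^ (- (p / 2)).
have e2 t : t0 < t -> e t ^+ 2 = 1 / t `^ p.
  by move=> t0t; rewrite sqr_powR_opp_half//; exact: lt_trans t0t.
have ode' t : t0 < t ->
    x'' t = - (delta * e t) *: x' t - gradient ip f (x t) - (e t ^+ 2) *: x t.
  move=> t0t; have := ode t (I_t t t0t); rewrite -e2// -powRN -/(e t).
  move=> /eqP; rewrite -!addrA addr_eq0 => /eqP ->.
  by rewrite !opprD scaleNr addrA.
have [lam [K [T [t0T ET]]]] := energy_bound norm_ip f_diff f_convex zP xs_min
  t0_gt0 delta_gt0 p_gt0 p_lt2 Dx Dx' ode'.
have dist t : T <= t -> `|x t - z (1 / t `^ p)| ^+ 2 <= 4 * K * t `^ (- ((2 - p) / 2)).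
  move=> Tt; have t0t := lt_le_trans t0T Tt; have tpos := lt_trans t0_gt0 t0t.
  have et2 : 0 < e t ^+ 2 by rewrite exprn_gt0// powR_gt0.
  have := le_trans (energy_dist zP p t0_gt0 x x' lam t0t) (ET t Tt).
  rewrite -e2// -powR_opp_half_ratio// -/(e t) => h.
  by rewrite mulrA ler_pdivlMr// mulrC; lra.
have rate1 t : 0 < t -> `|t `^ (- ((2 - p) / 2))| = t `^ (- ((2 - p) / 2)).
  by move=> tpos; rewrite ger0_norm// powR_ge0.
have rate_gt0 : 0 < (2 - p) / 2 by rewrite divr_gt0// subr_gt0.
split.
- have minE : min_value f = f xs.
    apply/eqP; rewrite eq_le; apply/andP; split.
      by apply: ge_inf; [exists (f xs) => _ [y _ <-]; exact: xs_min.2|exists xs].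
    by apply: lb_le_inf; [exists (f xs), xs|move=> _ [y _ <-]; exact: xs_min.2].
  apply/eqO_exP; exists (`|K| + `|xs| ^+ 2 / 2 + 1).
    by rewrite ltr_wpDl// addr_ge0// divr_ge0// exprn_ge0.
  have [T1 [_ T1P]] := powR_opp_small rate_gt0 (@ltr01 R).
  near=> t.
  have Tt : T <= t by near: t; apply: nbhs_pinfty_ge; exact: num_real.
  have T1t : T1 <= t by near: t; apply: nbhs_pinfty_ge; exact: num_real.
  have t0t := lt_le_trans t0T Tt; have tpos := lt_trans t0_gt0 t0t.
  have et2 : 0 < e t ^+ 2 by rewrite exprn_gt0// powR_gt0.
  rewrite minE ger0_norm ?subr_ge0; last exact: xs_min.2.
  rewrite -e2// (gtr0_norm et2).
  (* The ratio of the two sides is t^(-(2 - p)/2), eventually at most 1; hence both terms of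
     [energy_value] are of order eps(t). *)
  have et_le : e t / t <= e t ^+ 2.
    have := T1P _ T1t; rewrite -powR_opp_half_ratio// ler_pdivrMr// mul1r.
    exact.
  have et_ge0 : 0 <= e t / t by rewrite divr_ge0 ?powR_ge0// ltW.
  have h1 := energy_value zP xs p t0_gt0 x x' lam t0t.
  have h2 := ET t Tt.
  have h3 : K * (e t / t) <= `|K| * (e t / t) by rewrite ler_wpM2r// ler_norm.
  have h4 : `|K| * (e t / t) <= `|K| * e t ^+ 2 by rewrite ler_wpM2l.
  rewrite -/(e t) in h1 h2.
  by apply: le_trans h1 _; move: h2 h3 h4 => ? ? ?; lra.
- exists (fun t => z (1 / t `^ p)); split=> [t t0t|].
    by apply: (tikhonov_unique zP); rewrite divr_gt0// powR_gt0// (lt_le_trans t0_gt0).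
  apply/eqO_exP; exists (4 * `|K| + 1); first by rewrite ltr_wpDl// mulr_ge0.
  near=> t.
  have Tt : T <= t by near: t; apply: nbhs_pinfty_ge; exact: num_real.
  have tpos := lt_trans t0_gt0 (lt_le_trans t0T Tt).
  have -> : 1 / t `^ ((2 - p) / 2) = t `^ (- ((2 - p) / 2)) by rewrite powRN div1r.
  rewrite rate1// ger0_norm ?exprn_ge0//.
  apply: le_trans (dist t Tt) _; apply: ler_wpM2r; first exact: powR_ge0.
  by have ? := ler_norm K; lra.
have [xstar xstarP z_cvg] := tikhonov_cvg norm_ip f_cont f_mid zP f_argmin.
exists xstar; split=> //.
(* The approach is from the right of 0, since [zP] controls [z] only at positive parameters. *)
have eps_cvg : (1 / t `^ p) @[t --> +oo] --> (0 : R)^'+.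
  move=> A [eta /= eta0 etaA].
  have [T1 [T10 T1P]] := powR_opp_small p_gt0 (divr_gt0 eta0 (ltr0Sn R 1)).
  suff : \forall t \near +oo, A (1 / t `^ p) by [].
  near=> t.
  have T1t : T1 <= t by near: t; apply: nbhs_pinfty_ge; exact: num_real.
  have tpos := lt_le_trans T10 T1t.
  have tp0 : 0 < 1 / t `^ p by rewrite divr_gt0// powR_gt0.
  apply: etaA => //=; rewrite sub0r normrN gtr0_norm// div1r -powRN.
  by apply: le_lt_trans (T1P _ T1t) _; rewrite ltr_pdivrMr// ltr_pMr// ltr1n.
have zt_cvg : z (1 / t `^ p) @[t --> +oo] --> xstar by exact: (cvg_comp _ _ eps_cvg z_cvg).
apply/cvgrPdist_le => d d0.
have d20 : 0 < d / 2 by rewrite divr_gt0.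
(* Chosen so that the bound in [dist] falls below [(d / 2) ^+ 2]. *)
have eta0 : 0 < (d / 2) ^+ 2 / (4 * `|K| + 1).
  by rewrite divr_gt0 ?exprn_gt0// ltr_wpDl// mulr_ge0.
have [T1 [_ T1P]] := powR_opp_small rate_gt0 eta0.
near=> t.
have Tt : T <= t by near: t; apply: nbhs_pinfty_ge; exact: num_real.
have T1t : T1 <= t by near: t; apply: nbhs_pinfty_ge; exact: num_real.
have zd : `|xstar - z (1 / t `^ p)| <= d / 2.
  by near: t; exact: (cvgr_dist_le _ _ zt_cvg _ d20).
have xd : `|x t - z (1 / t `^ p)| <= d / 2.
  rewrite -(@ler_pXn2r _ 2) ?nnegrE ?(ltW d20)//; apply: le_trans (dist t Tt) _.
  have K0 : 0 < 4 * `|K| + 1 by rewrite ltr_wpDl// mulr_ge0.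
  apply: (@le_trans _ _ ((4 * `|K| + 1) * t `^ (- ((2 - p) / 2)))).
    by apply: ler_wpM2r; [exact: powR_ge0|have ? := ler_norm K; lra].
  by rewrite mulrC -ler_pdivlMr//; exact: T1P.
rewrite -[xstar - x t](subrKA (z (1 / t `^ p))).
by apply: le_trans (ler_normD _ _) _; rewrite (distrC _ (x t)); lra.
Unshelve. all: by end_near. Qed.
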